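(* Let $n\ge 1$ and define $$D_n(z)=\prod_{r=1}^n\left(z^2+4\sin^2\left(\frac{\pi r}{2n+1}\right)z+1\right),\qquad A_{2n+1}(z)=-z^{2n+1}\,\frac{\det\big(I-M(-z)^{2n+1}\big)}{1-z+z^2-z^3}.$$ Then $$A_{2n+1}(z)=(1+z+\cdots+z^{2n})\,D_n(z)^2,$$ and $D_n(z)$ has positive real coefficients (i.e. the coefficients of $z^0,\dots,z^{2n}$ in $D_n$ are all positive real numbers).
   Context: The matrix $$M(t)=\begin{pmatrix}1-t&1-t^{-1}&-1\\1&1-t^{-1}&-1\\0&t&-t\end{pmatrix}$$ is the image of $\sigma_1\sigma_2^{-1}\sigma_3\in B_4$ under the reduced Burau representation over $\mathbb{Z}[t,t^{-1}]$; $M(-z)$ is its evaluation at $t=-z$. $A_{2n+1}(z)$ is the normalized Alexander polynomial of the knot $Th(4,2n+1)$, the closure of $(\sigma_1\sigma_2^{-1}\sigma_3)^{2n+1}$. *)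

(* Defs.v *)
From mathcomp Require Import all_boot all_order all_algebra.
From mathcomp Require Import reals trigo.

Set Implicit Arguments.
Unset Strict Implicit.
Unset Printing Implicit Defensive.

Import Order.TTheory GRing.Theory Num.Theory.
Local Open Scope ring_scope.

(* The image of sigma_1 sigma_2^-1 sigma_3 (4-strand braid group) under the
   reduced Burau representation, over Z[t, t^-1], specialized at t in F. *)
Definition burau_M (F : fieldType) (t : F) : 'M[F]_3 :=
  \matrix_(i < 3, j < 3)
    nth 0 (nth [::] [:: [:: 1 - t; 1 - t^-1; - 1];
                        [:: 1;     1 - t^-1; - 1];
                        [:: 0;     t;        - t]] i) j.

(* The indeterminate z, seen in the field R(z) of rational functions. *)
Definition ratz (R : realType) : {fraction {poly R}} := tofrac 'X.

(* For odd m, A m is the normalized Alexander polynomial of the closure of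
   (sigma_1 sigma_2^-1 sigma_3)^m; by this formula it is a priori only a
   rational function of z.  Both z and the denominator are nonzero in R(z), so
   the conventions for inverting 0 play no role. *)
Definition A (R : realType) (m : nat) : {fraction {poly R}} :=
  let z := ratz R in
  - z ^+ m * (\det (1 - burau_M (- z) ^+ m) / (1 - z + z ^+ 2 - z ^+ 3)).

Definition D (R : realType) (n : nat) : {poly R} :=
  \prod_(1 <= r < n.+1)
    ('X^2 + (4 * sin (pi * r%:R / (2 * n + 1)%:R) ^+ 2) *: 'X + 1).

(* Main.v *)
Require Import Defs.
From mathcomp Require Import all_boot all_order all_algebra.
From mathcomp Require Import reals trigo ring zify.

Import Order.TTheory GRing.Theory Num.Theory.
Local Open Scope ring_scope.

(** The characteristic polynomial of [M(-z)] splits as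
    [(x - z) (x^2 - s x + 1)] with [s = 2 + z + z^-1], so the eigenvalues are
    [z], [a] and [a^-1] with [a + a^-1 = s].  Put [m = 2n+1] and
    [c_r = 2 cos (2 pi r / m)].  Over the reals,
    [x^m - 1 = (x - 1) \prod_r (x^2 - c_r x + 1)], the product ranging over
    [1 <= r <= n] ([Xn_sub1_factor]).  Substituting [M(-z)] for [x] and taking
    determinants writes [det (1 - M(-z)^m)] as the product of
    [det (1 - M(-z)) = (1 - z) (2 - s)] and of the determinants
    [det (M^2 - c_r M + 1) = (z^2 - c_r z + 1) (s - c_r)^2], where the first
    factor comes from the eigenvalue [z] and the square from [a] and [a^-1].
    Working with [M] itself makes it unnecessary to adjoin [a].

    The factors coming from [z] multiply up to [1 + z + ... + z^(2n)], by the
    same factorization of [x^m - 1].  As [2 - c_r = 4 sin^2 (pi r / m)], the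
    number [s - c_r] is the [r]-th factor of [D_n] divided by [z], so that the
    squares multiply up to [D_n^2 / z^(2n)].  What is left,
    [(1 - z) (2 - s) = - (1 - z) (1 + z^2) / z], is cancelled by the
    normalization, since [1 - z + z^2 - z^3 = (1 - z) (1 + z^2)].

    Positivity: each factor of [D_n] has positive coefficients in degrees 0, 1
    and 2, and a product of polynomials without gaps in their positive
    coefficients again has none ([coef_mul_gt0]). *)

(** * Positive coefficients *)

(** The coefficient of degree [i <= a + b] of the product is a sum of
    nonnegative terms, among which [p`_j * q`_(i - j)] with [j = min i a] is
    positive. *)
Lemma coef_mul_gt0 (R : numDomainType) (p q : {poly R}) (a b : nat) :
  (forall i, 0 <= p`_i) -> (forall i, (i <= a)%N -> 0 < p`_i) ->
  (forall i, 0 <= q`_i) -> (forall i, (i <= b)%N -> 0 < q`_i) ->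
  (forall i, 0 <= (p * q)`_i) /\ (forall i, (i <= a + b)%N -> 0 < (p * q)`_i).
Proof.
move=> p_ge0 p_gt0 q_ge0 q_gt0; split=> i => [|le_i_ab]; rewrite coefM.
  by apply: sumr_ge0 => j _; rewrite mulr_ge0.
have lt_j : (minn i a < i.+1)%N by rewrite ltnS geq_minl.
rewrite (bigD1 (Ordinal lt_j)) //= ltr_wpDr //.
  by apply: sumr_ge0 => j _; rewrite mulr_ge0.
by rewrite mulr_gt0 ?p_gt0 ?q_gt0 ?geq_minr //; lia.
Qed.

Lemma coef_prod_quad_gt0 (R : numDomainType) (a : nat -> R) (n : nat) :
  (forall r, (1 <= r < n.+1)%N -> 0 < a r) ->
  (forall i, 0 <= (\prod_(1 <= r < n.+1) ('X^2 + a r *: 'X + 1))`_i) /\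
  forall i, (i <= 2 * n)%N ->
  0 < (\prod_(1 <= r < n.+1) ('X^2 + a r *: 'X + 1))`_i.
Proof.
elim: n => [|n IHn] a_gt0.
  rewrite big_geq // muln0; split=> i; rewrite coef1; first by rewrite ler0n.
  by case: i => // _; rewrite ltr01.
have [|ge0 gt0] := IHn.
  by move=> r /andP[r_ge1 ltrn]; rewrite a_gt0 // r_ge1 ltnS ltnW.
have an_gt0 : 0 < a n.+1 by rewrite a_gt0 // leqnn.
rewrite big_nat_recr //= mulnS addnC.
have coefE i : ('X^2 + a n.+1 *: 'X + 1)`_i =
    (i == 2)%:R + a n.+1 * (i == 1)%:R + (i == 0)%:R.
  by rewrite !coefD coefZ coefXn coefX coef1.
apply: coef_mul_gt0 => // i; rewrite coefE.
  case: i => [|[|[|i]]] /=;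
    by rewrite ?mulr0 ?mulr1 ?add0r ?addr0 ?ler01 ?(ltW an_gt0).
by case: i => [|[|[|i]]] //= _; rewrite ?mulr0 ?mulr1 ?add0r ?addr0 ?ltr01.
Qed.

(** * Palindromic quadratic polynomials *)

Lemma size_quad_tail (F : fieldType) (a : F) :
  (size (- a *: 'X + 1 : {poly F})%R < size ('X^2 : {poly F}))%N.
Proof.
rewrite size_polyXn ltnS (leq_trans (size_polyD _ _)) // size_poly1.
by rewrite geq_max andbT (leq_trans (size_scale_leq _ _)) ?size_polyX.
Qed.

Lemma size_quad (F : fieldType) (a : F) : size ('X^2 - a *: 'X + 1) = 3%N.
Proof. by rewrite -addrA -scaleNr size_polyDl ?size_quad_tail ?size_polyXn. Qed.

Lemma quad_monic (F : fieldType) (a : F) : 'X^2 - a *: 'X + 1 \is monic.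
Proof.
by rewrite monicE -addrA -scaleNr lead_coefDl ?size_quad_tail ?lead_coefXn.
Qed.

(** A common divisor divides the difference, a nonzero multiple of ['X], but
    is coprime to ['X] because the constant terms are 1. *)
Lemma quad_coprime (F : fieldType) (a b : F) : a != b ->
  coprimep ('X^2 - a *: 'X + 1) ('X^2 - b *: 'X + 1).
Proof.
move=> neq_ab; set p := (X in coprimep X _).
have -> : 'X^2 - b *: 'X + 1 = 1 * p + (a - b) *: 'X :> {poly F}.
  by rewrite /p -!mul_polyC !polyCD !polyCN; ring.
rewrite coprimep_addl_mul coprimepZr ?subr_eq0 // coprimep_sym.
have -> : p = ('X - a%:P) * 'X + 1 by rewrite /p -!mul_polyC; ring.
by rewrite coprimep_addl_mul coprimep1.
Qed.

Lemma quad_coprime_XsubC1 (F : fieldType) (a : F) : a != 2 ->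
  coprimep ('X - 1) ('X^2 - a *: 'X + 1).
Proof.
move=> neq_a2.
have -> : 'X^2 - a *: 'X + 1
    = ('X + 1 - a%:P) * ('X - 1) + (2 - a)%:P :> {poly F}.
  by rewrite -!mul_polyC polyCB -[2%:P]/((2%:R)%:P) polyC_natr; ring.
rewrite coprimep_addl_mul -[_%:P]mulr1 mul_polyC coprimepZr ?coprimep1 //.
by rewrite subr_eq0 eq_sym.
Qed.

(** * Real factorization of [x^(2n+1) - 1] *)

(** The roots of [q = X^2 - 2 cos x X + 1] are [exp (i x)] and [exp (- i x)],
    which are [m]-th roots of unity by the hypothesis on [x *+ m].  To stay
    over the reals, the proof computes ['X^k] modulo [q], which is
    [(sin (k x) X - sin ((k - 1) x)) / sin x]. *)
Lemma quad_cos_dvdp (R : realType) (x : R) (m : nat) :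
  sin x != 0 -> cos (x *+ m) = 1 ->
  'X^2 - (2 * cos x) *: 'X + 1 %| ('X^m - 1 : {poly R}).
Proof.
move=> sx0 cmx; set q := (X in X %| _).
have smx : sin (x *+ m) = 0.
  by apply/eqP; rewrite -sqrf_eq0 sin2cos2 cmx expr1n subrr.
have rem_Xn k :
    q %| sin x *: 'X^k - sin (x *+ k) *: 'X + (sin (x *+ k - x))%:P.
  elim: k => [|k IHk].
    by rewrite mulr0n sin0 scale0r subr0 sub0r sinN alg_polyC polyCN subrr.
  have -> : (sin x *: 'X^(k.+1) : {poly R}) - sin (x *+ k.+1) *: 'X
        + (sin (x *+ k.+1 - x))%:P
      = ('X : {poly R}) * (sin x *: 'X^k - sin (x *+ k) *: 'X
        + (sin (x *+ k - x))%:P) + (sin (x *+ k))%:P * q.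
    rewrite mulrSr addrK sinB sinD /q exprS -!mul_polyC.
    rewrite !polyCD !polyCN !polyCM.
    have -> : 2%:P = 2 :> {poly R} by rewrite rmorph_nat.
    ring.
  by rewrite dvdp_add ?dvdp_mull.
have := rem_Xn m; rewrite sinB smx cmx mul0r mul1r sub0r scale0r subr0.
by rewrite polyCN -alg_polyC -scalerBr dvdpZr.
Qed.

(** For [1 <= r <= n], twice this angle is the argument of a nontrivial
    [(2 n + 1)]-th root of unity; the angle itself occurs in [D]. *)
Definition half_angle (R : realType) (n r : nat) : R :=
  pi * r%:R / (2 * n + 1)%:R.

Lemma half_angle_gt0 (R : realType) n r : (1 <= r)%N -> 0 < half_angle R n r.
Proof. by move=> r1; rewrite divr_gt0 ?mulr_gt0 ?pi_gt0 ?ltr0n ?addn1. Qed.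

Lemma half_angle2_lt_pi (R : realType) n r :
  (r <= n)%N -> half_angle R n r *+ 2 < pi.
Proof.
move=> r_le; rewrite /half_angle -[_ *+ 2]mulr_natr mulrAC.
rewrite ltr_pdivrMr ?ltr0n ?addn1 //.
by rewrite -mulrA ltr_pM2l ?pi_gt0 // -natrM ltr_nat; lia.
Qed.

Lemma half_angle_inj (R : realType) n : injective (half_angle R n).
Proof.
move=> r s; rewrite /half_angle => /mulIf.
rewrite invr_eq0 pnatr_eq0 addn1 => /(_ isT).
by move/mulfI; rewrite gt_eqF ?pi_gt0 // => /(_ isT) /eqP; rewrite eqr_nat => /eqP.
Qed.

(** All factors on the right divide the left-hand side.  They are pairwise
    coprime because the doubled angles lie strictly between [0] and [pi], where
    [cos] is injective and less than 1.  Hence their product divides the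
    left-hand side, and both are monic of the same degree. *)
Lemma Xn_sub1_factor (R : realType) (n : nat) :
  'X^(2 * n + 1) - 1 = ('X - 1) *
    \prod_(1 <= r < n.+1)
      ('X^2 - (2 * cos (half_angle R n r *+ 2)) *: 'X + 1) :> {poly R}.
Proof.
set q := fun r => 'X^2 - (2 * cos (half_angle R n r *+ 2)) *: 'X + 1.
have in0pi r : (1 <= r <= n)%N -> 0 < half_angle R n r *+ 2 < pi.
  by case/andP=> r1 rn; rewrite pmulrn_lgt0 // half_angle_gt0 ?half_angle2_lt_pi.
have q_dvd r : (1 <= r <= n)%N -> q r %| 'X^(2 * n + 1) - 1.
  move=> rn; apply: quad_cos_dvdp; first by rewrite gt_eqF ?sin_gt0_pi ?in0pi.
  have -> : half_angle R n r *+ 2 *+ (2 * n + 1) = 0 + pi *+ 2 *+ r.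
    rewrite add0r mulrnAC [RHS]mulrnAC; congr (_ *+ 2).
    by rewrite -[LHS]mulr_natr divfK ?mulr_natr // pnatr_eq0 addn1.
  by rewrite (periodicn (@cosD2pi R)) cos0.
have cos_uniq r s : (1 <= r <= n)%N -> (1 <= s <= n)%N ->
    cos (half_angle R n r *+ 2) = cos (half_angle R n s *+ 2) -> r = s.
  move=> /in0pi/andP[r0 rpi] /in0pi/andP[s0 spi] /cos_inj.
  rewrite !in_itv /= !ltW //= => /(_ isT isT) /eqP.
  by rewrite eqrMn2r => /eqP /half_angle_inj.
have cos_neq1 r : (1 <= r <= n)%N -> 2 * cos (half_angle R n r *+ 2) != 2.
  move=> /in0pi/andP[r0 rpi].
  rewrite -subr_eq0 -[X in _ - X]mulr1 -mulrBr mulf_eq0 pnatr_eq0 /= subr_eq0.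
  apply/eqP; rewrite -(@cos0 R) => /cos_inj.
  rewrite !in_itv /= lexx pi_ge0 !ltW //= => /(_ isT isT) e.
  by rewrite e ltxx in r0.
have dvd k : (k <= n)%N ->
    ('X - 1) * \prod_(1 <= r < k.+1) q r %| 'X^(2 * n + 1) - 1.
  elim: k => [_|k IHk lt_kn].
    rewrite big_geq // mulr1 -polyC1 dvdp_XsubCl polyC1 rootE.
    by rewrite !hornerE expr1n subrr.
  rewrite big_nat_recr //= mulrA Gauss_dvdp ?(IHk (ltnW lt_kn)) ?q_dvd //.
  rewrite coprimepMl quad_coprime_XsubC1 ?cos_neq1 //= big_nat.
  apply: (big_ind (fun p => coprimep p (q k.+1))) => [|u v cu cv|r].
  - exact: coprime1p.
  - by rewrite coprimepMl cu.
  case/andP=> r1 rk; apply: quad_coprime.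
  rewrite (inj_eq (mulfI _)) ?pnatr_eq0 //.
  apply/eqP => e.
  have r_le_n : (1 <= r <= n)%N by rewrite r1 ltnW ?(leq_trans rk).
  by move: rk; rewrite (cos_uniq r k.+1) ?ltnn.
have q_neq0 r : q r != 0 by rewrite monic_neq0 ?quad_monic.
have prod_monic : \prod_(1 <= r < n.+1) q r \is monic.
  by rewrite monic_prod // => r _; apply: quad_monic.
have X1_monic : 'X - 1 \is @monic R by rewrite -polyC1 monicXsubC.
have Xn_monic : 'X^(2 * n + 1) - 1 \is @monic R.
  by rewrite -polyC1 monicXnsubC ?addn1.
apply/esym/eqP; rewrite -eqp_monic ?rpredM // -dvdp_size_eqp ?dvd //.
rewrite size_mul ?monic_neq0 //.
have -> : size ('X - 1 : {poly R}) = 2%N by rewrite -polyC1 size_XsubC.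
have -> : size ('X^(2 * n + 1) - 1 : {poly R}) = (2 * n + 2)%N.
  by rewrite -polyC1 size_XnsubC addn1 // addn2.
rewrite size_prod_seq => [|r _]; last exact: q_neq0.
rewrite (eq_bigr (fun=> 3%N)) => [|r _]; last exact: size_quad.
by rewrite sum_nat_const_nat size_iota; lia.
Qed.

Lemma geometric_sum_factor (R : realType) (n : nat) :
  \sum_(0 <= i < (2 * n).+1) 'X^i =
    \prod_(1 <= r < n.+1)
      ('X^2 - (2 * cos (half_angle R n r *+ 2)) *: 'X + 1) :> {poly R}.
Proof.
apply: (@mulfI _ ('X - 1)); first by rewrite -polyC1 polyXsubC_eq0.
by rewrite -Xn_sub1_factor addn1 subrX1 big_mkord.
Qed.

(** * Determinants of polynomials in the Burau matrix *)

Lemma det3E (R : comNzRingType) (a : nat -> nat -> R) :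
  \det (\matrix_(i < 3, j < 3) a i j) =
    a 0%N 0%N * (a 1%N 1%N * a 2%N 2%N - a 1%N 2%N * a 2%N 1%N)
    - a 0%N 1%N * (a 1%N 0%N * a 2%N 2%N - a 1%N 2%N * a 2%N 0%N)
    + a 0%N 2%N * (a 1%N 0%N * a 2%N 1%N - a 1%N 1%N * a 2%N 0%N).
Proof.
rewrite (expand_det_row _ ord0) !big_ord_recl big_ord0 /cofactor.
rewrite !(expand_det_row _ ord0) !big_ord_recl !big_ord0 /cofactor !det_mx11.
by rewrite !mxE /= /bump /=; ring.
Qed.

(** Entries indexed by natural numbers, so that they compute on numerals. *)
Definition burau_entry (F : fieldType) (t : F) (i j : nat) : F :=
  nth 0 (nth [::] [:: [:: 1 - t; 1 - t^-1; - 1];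
                      [:: 1;     1 - t^-1; - 1];
                      [:: 0;     t;        - t]] i) j.

(** The eigenvalues of [burau_M t] are [- t] and the two roots of
    [x^2 - s x + 1], where [s = 2 - t - t^-1].  The values of [x^2 - c x + 1]
    at these two roots [a] and [a^-1] are [a (s - c)] and [a^-1 (s - c)]. *)
Lemma det_burau_quad (F : fieldType) (t c : F) : t != 0 ->
  \det (burau_M t ^+ 2 - c *: burau_M t + 1) =
  (t ^+ 2 + c * t + 1) * (2 - t - t^-1 - c) ^+ 2.
Proof.
move=> t_neq0; pose m := burau_entry F t.
pose a (i j : nat) : F :=
  m i 0%N * m 0%N j + m i 1%N * m 1%N j + m i 2%N * m 2%N j
  - c * m i j + (i == j)%:R.
have -> : burau_M t ^+ 2 - c *: burau_M t + 1 = \matrix_(i < 3, j < 3) a i j.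
  apply/matrixP=> i j; rewrite expr2 !mxE !big_ord_recl !big_ord0 !mxE /=.
  by rewrite /bump /a /m /burau_entry /= addr0 !addrA.
by rewrite det3E /a /m /burau_entry /=; field.
Qed.

Lemma det_burau_one_sub (F : fieldType) (t : F) : t != 0 ->
  \det (1 - burau_M t) = (1 + t) * (t + t^-1).
Proof.
move=> t_neq0.
pose a (i j : nat) : F := (i == j)%:R - burau_entry F t i j.
have -> : 1 - burau_M t = \matrix_(i < 3, j < 3) a i j.
  by apply/matrixP=> i j; rewrite !mxE.
by rewrite det3E /a /burau_entry /=; field.
Qed.

(** [Xn_sub1_factor] evaluated at the Burau matrix; [f] moves the real
    coefficients into the field of the entries. *)
Lemma det_burau_one_sub_pow (R : realType) (F : fieldType)
    (f : {rmorphism R -> F}) (t : F) (n : nat)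
    (c := fun r => f (2 * cos (half_angle R n r *+ 2))) :
  t != 0 ->
  \det (1 - burau_M t ^+ (2 * n + 1)) =
    (1 + t) * (t + t^-1) *
    \prod_(1 <= r < n.+1) ((t ^+ 2 + c r * t + 1) * (2 - t - t^-1 - c r) ^+ 2).
Proof.
move=> t_neq0.
have one_subXn : 1 - 'X^(2 * n + 1) = (1 - 'X) *
    \prod_(1 <= r < n.+1)
      ('X^2 - (2 * cos (half_angle R n r *+ 2)) *: 'X + 1) :> {poly R}.
  by rewrite -opprB Xn_sub1_factor -mulNr opprB.
have := congr1 (horner_mx (burau_M t) \o map_poly f) one_subXn.
rewrite /= !rmorphM !rmorphB !rmorphXn !rmorph1 /= map_polyX horner_mx_X => ->.
rewrite det_mulmx det_burau_one_sub //; congr (_ * _).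
rewrite !rmorph_prod /= (big_morph _ (@det_mulmx _ 3) (det1 _ 3)).
apply: eq_bigr => r _; rewrite -det_burau_quad //; congr (\det _).
rewrite !rmorphD !rmorphN !rmorphXn !rmorph1 /= map_polyZ map_polyX.
by rewrite linearZ /= horner_mx_X.
Qed.

(** * The Alexander polynomial *)

Lemma two_sub_cos (R : realType) (x : R) :
  2 - 2 * cos (x *+ 2) = 4 * sin x ^+ 2.
Proof. by rewrite cos_mulr2n sin2cos2; ring. Qed.

(** All that matters about rational functions is that they form a field into
    which the polynomials embed.  Injectivity of the embedding makes [z],
    [1 - z] and [z ^+ 2 + 1] invertible, and with them the denominators. *)
Lemma burau_alexander_polynomial (R : realType) (F : fieldType)
    (g : {rmorphism {poly R} -> F}) (n : nat) (z := g 'X) :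
  injective g ->
  - z ^+ (2 * n + 1) *
    (\det (1 - burau_M (- z) ^+ (2 * n + 1)) / (1 - z + z ^+ 2 - z ^+ 3)) =
  g ((\sum_(0 <= i < (2 * n).+1) 'X^i) * D R n ^+ 2).
Proof.
move=> g_inj; pose f : {rmorphism R -> F} := g \o polyC.
have z_neq0 : z != 0 by rewrite raddf_eq0 ?polyX_eq0.
have z1_neq0 : 1 - z != 0.
  rewrite -(rmorph1 g) -rmorphB raddf_eq0 //.
  by rewrite -oppr_eq0 opprB -polyC1 polyXsubC_eq0.
have z2_neq0 : z ^+ 2 + 1 != 0.
  rewrite -(rmorph1 g) -rmorphXn -rmorphD raddf_eq0 // monic_neq0 //.
  by rewrite -[X in X + 1]subr0 -[X in _ - X](scale0r 'X) quad_monic.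
have g_quad a : g ('X^2 + a *: 'X + 1) = z ^+ 2 + f a * z + 1.
  by rewrite -mul_polyC !rmorphD rmorphXn rmorphM rmorph1.
rewrite (det_burau_one_sub_pow R _ f) ?oppr_eq0 // big_split /=.
have -> : \prod_(1 <= r < n.+1)
      ((- z) ^+ 2 + g (2 * cos (half_angle R n r *+ 2))%:P * - z + 1)
    = g (\sum_(0 <= i < (2 * n).+1) 'X^i).
  rewrite geometric_sum_factor rmorph_prod; apply: eq_bigr => r _ /=.
  by rewrite -scaleNr g_quad rmorphN sqrrN mulrN mulNr.
have -> : \prod_(1 <= r < n.+1)
      (2 - (- z) - (- z)^-1 - g (2 * cos (half_angle R n r *+ 2))%:P) ^+ 2
    = g (D R n) ^+ 2 / z ^+ (2 * n).
  rewrite prodrXl mulnC exprM -expr_div_n; congr (_ ^+ 2).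
  have -> : z ^+ n = \prod_(1 <= r < n.+1) z by rewrite prodr_const_nat subn1.
  rewrite rmorph_prod -prodf_div; apply: eq_bigr => r _ /=.
  rewrite g_quad -[pi * _ / _]/(half_angle R n r) -two_sub_cos.
  rewrite (rmorphB f) rmorph_nat.
  change (f (2 * cos _)) with (g (2 * cos (half_angle R n r *+ 2))%:P).
  by field; rewrite oppr_eq0 -/z z_neq0.
rewrite rmorphM rmorphXn addn1 exprS.
have -> : 1 - z + z ^+ 2 - z ^+ 3 = (1 - z) * (z ^+ 2 + 1) by ring.
have zn_neq0 : z ^+ (2 * n) != 0 by rewrite expf_neq0.
move: (z ^+ (2 * n)) zn_neq0 => y y_neq0.
by field; rewrite oppr_eq0 -/z z_neq0 z1_neq0 z2_neq0 y_neq0.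
Qed.

Theorem proposition3p11 (R : realType) (n : nat) (n_ge1 : (1 <= n)%N) :
  A R (2 * n + 1) = tofrac ((\sum_(0 <= i < (2 * n).+1) 'X^i) * D R n ^+ 2)
  /\ (forall i : nat, (i <= 2 * n)%N -> 0 < (D R n)`_i).
Proof.
split.
  have tofrac_inj : injective (@tofrac {poly R}).
    by move=> p q /eqP; rewrite tofrac_eq => /eqP.
  exact: (burau_alexander_polynomial R _ (@tofrac {poly R}) n tofrac_inj).
apply: (coef_prod_quad_gt0 _ _ n _).2 => r /andP[r1 rn].
rewrite mulr_gt0 ?ltr0n // exprn_gt0 // sin_gt0_pi // half_angle_gt0 //=.
rewrite (le_lt_trans _ (half_angle2_lt_pi R n r rn)) //.
by rewrite mulr2n lerDl ltW ?half_angle_gt0.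
Qed.
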